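(* Let $(\boldsymbol{X}_t)_{t\in\mathbb{R}_+}$ be a multi-type CBI process with parameters $(d,\boldsymbol{c},\boldsymbol{\beta},\boldsymbol{B},\nu,\boldsymbol{\mu})$ such that $\int_{\mathcal{U}_d}\|\boldsymbol{r}\|\,\mathbf{1}_{\{\|\boldsymbol{r}\|\ge1\}}\,\nu(\mathrm{d}\boldsymbol{r})<\infty$. Let $\boldsymbol{x}\in\mathbb{R}_+^d$, $k\in\mathbb{N}$, $0=:t_0\le t_1\le t_2\le\dots\le t_k$ and $\boldsymbol{\lambda}_i\in\mathbb{R}_+^d$, $i\in\{1,\dots,k\}$. Then $$\mathbb{E}\Big(e^{-\sum_{i=1}^k\langle\boldsymbol{\lambda}_i,\boldsymbol{X}_{t_i}\rangle}\,\Big|\,\boldsymbol{X}_0=\boldsymbol{x}\Big)=\exp\Big\{-\big\langle\boldsymbol{x},\boldsymbol{v}\big(t_1,\boldsymbol{y}^{(k)}_1\big)\big\rangle-\sum_{i=1}^k\int_0^{t_i-t_{i-1}}\psi\big(\boldsymbol{v}(u,\boldsymbol{y}^{(k)}_i)\big)\,\mathrm{d}u\Big\},$$ where the vectors $\boldsymbol{y}^{(k)}_1,\dots,\boldsymbol{y}^{(k)}_k\in\mathbb{R}_+^d$ are defined by $$\boldsymbol{y}^{(k)}_k:=\boldsymbol{\lambda}_k,\qquad\boldsymbol{y}^{(k)}_i:=\boldsymbol{\lambda}_i+\boldsymbol{v}\big(t_{i+1}-t_i,\boldsymbol{y}^{(k)}_{i+1}\big),\quad i\in\{1,\dots,k-1\},$$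 $\psi$ is the immigration mechanism of $(\boldsymbol{X}_t)_{t\in\mathbb{R}_+}$, and, for any $\boldsymbol{\lambda}\in\mathbb{R}_+^d$, the continuously differentiable function $\mathbb{R}_+\ni t\mapsto\boldsymbol{v}(t,\boldsymbol{\lambda})\in\mathbb{R}_+^d$ is the unique locally bounded solution to $\partial_1v_i(t,\boldsymbol{\lambda})=-\varphi_i(\boldsymbol{v}(t,\boldsymbol{\lambda}))$, $t\in\mathbb{R}_+$, $v_i(0,\boldsymbol{\lambda})=\lambda_i$, $i\in\{1,\dots,d\}$, with $(\varphi_1,\dots,\varphi_d)$ the branching mechanism of $(\boldsymbol{X}_t)_{t\in\mathbb{R}_+}$.
   Context: $\mathbb{R}_+=[0,\infty)$; $\mathcal{U}_d:=\mathbb{R}_+^d\setminus\{\boldsymbol{0}\}$; $\boldsymbol{e}_1^{(d)},\dots,\boldsymbol{e}_d^{(d)}$ is the natural basis of $\mathbb{R}^d$; $\partial_1$ is the derivative in the first variable. A tuple $(d,\boldsymbol{c},\boldsymbol{\beta},\boldsymbol{B},\nu,\boldsymbol{\mu})$ is a set of admissible parameters if $d\in\mathbb{N}$; $\boldsymbol{c},\boldsymbol{\beta}\in\mathbb{R}_+^d$; $\boldsymbol{B}=(b_{i,j})\in\mathbb{R}^{d\times d}$ with $b_{i,j}\ge0$ for $i\ne j$; $\nu$ is a Borel measure on $\mathcal{U}_d$ with $\int_{\mathcal{U}_d}(1\wedge\|\boldsymbol{r}\|)\,\nu(\mathrm{d}\boldsymbol{r})<\infty$; $\boldsymbol{\mu}=(\mu_1,\dots,\mu_d)$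 where each $\mu_i$ is a Borel measure on $\mathcal{U}_d$ with $\int_{\mathcal{U}_d}\big[\|\boldsymbol{z}\|\wedge\|\boldsymbol{z}\|^2+\sum_{j\ne i}(1\wedge z_j)\big]\mu_i(\mathrm{d}\boldsymbol{z})<\infty$. A multi-type CBI process with admissible parameters $(d,\boldsymbol{c},\boldsymbol{\beta},\boldsymbol{B},\nu,\boldsymbol{\mu})$ is a conservative time-homogeneous Markov process on $\mathbb{R}_+^d$ whose transition semigroup satisfies $$\int_{\mathbb{R}_+^d}e^{-\langle\boldsymbol{\lambda},\boldsymbol{y}\rangle}P_t(\boldsymbol{x},\mathrm{d}\boldsymbol{y})=\exp\Big\{-\langle\boldsymbol{x},\boldsymbol{v}(t,\boldsymbol{\lambda})\rangle-\int_0^t\psi(\boldsymbol{v}(s,\boldsymbol{\lambda}))\,\mathrm{d}s\Big\},\qquad \boldsymbol{x},\boldsymbol{\lambda}\in\mathbb{R}_+^d,\ t\in\mathbb{R}_+,$$ where $t\mapsto\boldsymbol{v}(t,\boldsymbol{\lambda})\in\mathbb{R}_+^d$ is the unique locally bounded solution to the system in the claim, the branching mechanism is $(\varphi_1,\dots,\varphi_d)$ with $\varphi_i(\boldsymbol{\lambda})=c_i\lambda_i^2-\langle\boldsymbol{B}\boldsymbol{e}_i^{(d)},\boldsymbol{\lambda}\rangle+\int_{\mathcal{U}_d}(e^{-\langle\boldsymbol{\lambda},\boldsymbol{z}\rangle}-1+\lambda_i(1\wedge z_i))\,\mu_i(\mathrm{d}\boldsymbol{z})$, and the immigration mechanism is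 $\psi(\boldsymbol{\lambda})=\langle\boldsymbol{\beta},\boldsymbol{\lambda}\rangle+\int_{\mathcal{U}_d}(1-e^{-\langle\boldsymbol{\lambda},\boldsymbol{r}\rangle})\,\nu(\mathrm{d}\boldsymbol{r})$. Existence and uniqueness of $(P_t)$ and $\boldsymbol{v}$, and continuity of $(t,\boldsymbol{\lambda})\mapsto\boldsymbol{v}(t,\boldsymbol{\lambda})$, are known. Conditioning on $\boldsymbol{X}_0=\boldsymbol{x}$ refers to the Markov process started from $\boldsymbol{x}$. *)

(* Defs.v *)
From HB Require Import structures.
From mathcomp Require Import all_boot all_order all_algebra.
From mathcomp Require Import all_classical all_reals all_analysis.

Set Implicit Arguments.
Unset Strict Implicit.
Unset Printing Implicit Defensive.

Import Order.TTheory GRing.Theory Num.Theory.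
Import numFieldNormedType.Exports.

Local Open Scope classical_set_scope.
Local Open Scope ring_scope.

(* The type R_+^d, with the topology induced by R^d and its Borel
   sigma-algebra. *)
Definition orthant_set (R : realType) (d : nat) : set 'rV[R]_d :=
  [set x | forall i, 0 <= x 0 i].

Definition orthant (R : realType) (d : nat) : Type :=
  set_type (@orthant_set R d).

Definition vec (R : realType) (d : nat) (x : orthant R d) : 'rV[R]_d :=
  set_val x.
Coercion vec : orthant >-> matrix.

Lemma orthant_set0 (R : realType) (d : nat) :
  (0 : 'rV[R]_d) \in @orthant_set R d.
Proof. by rewrite inE => i; rewrite mxE. Qed.

Definition orthant0 (R : realType) (d : nat) : orthant R d :=
  exist _ 0 (orthant_set0 R d).

HB.instance Definition _ (R : realType) (d : nat) :=
  Topological.on (orthant R d).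
HB.instance Definition _ (R : realType) (d : nat) :=
  isPointed.Build (orthant R d) (orthant0 R d).
HB.instance Definition _ (R : realType) (d : nat) :=
  @isMeasurable.Build (sigma_display (@open (orthant R d))) (orthant R d)
    <<s @open (orthant R d) >> (@sigma_algebra0 _ setT _)
    (@sigma_algebraC (orthant R d) _) (@sigma_algebra_bigcup _ setT _).

Definition dotp (R : realType) (d : nat) (x y : 'rV[R]_d) : R :=
  \sum_i x 0 i * y 0 i.

(* The Euclidean norm; the library's norm on matrices is the sup norm. *)
Definition enorm (R : realType) (d : nat) (x : 'rV[R]_d) : R :=
  Num.sqrt (dotp x x).

Definition punctured (R : realType) (d : nat) : set (orthant R d) :=
  [set z | z <> orthant0 R d].

(* A Borel measure on U_d = R_+^d \ {0} is represented by its extension to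
   R_+^d that does not charge the origin (see [admissible]). *)
Record cbi_params (R : realType) (d : nat) := CBIParams {
  cbi_c : orthant R d ;
  cbi_beta : orthant R d ;
  cbi_B : 'M[R]_d ;
  cbi_nu : {measure set (orthant R d) -> \bar R} ;
  cbi_mu : 'I_d -> {measure set (orthant R d) -> \bar R} }.

Record admissible (R : realType) (d : nat) (p : cbi_params R d) : Prop := {
  adm_dim : (0 < d)%N ;
  adm_B : forall i j : 'I_d, i != j -> 0 <= cbi_B p i j ;
  adm_nu0 : cbi_nu p [set orthant0 R d] = 0%E ;
  adm_nu : (\int[cbi_nu p]_(r in @punctured R d)
              (Num.min 1 (enorm (vec r)))%:E < +oo)%E ;
  adm_mu0 : forall i, cbi_mu p i [set orthant0 R d] = 0%E ;
  adm_mu : forall i, (\int[cbi_mu p i]_(z in @punctured R d)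
              (Num.min (enorm (vec z)) (enorm (vec z) ^+ 2)
               + \sum_(j < d | j != i) Num.min 1 (vec z 0 j))%:E < +oo)%E }.

Definition branching (R : realType) (d : nat) (p : cbi_params R d) (i : 'I_d)
    (lam : orthant R d) : R :=
  cbi_c p 0 i * lam 0 i ^+ 2 - dotp (col i (cbi_B p))^T lam
  + \int[cbi_mu p i]_(z in @punctured R d)
      (expR (- dotp lam (vec z)) - 1 + lam 0 i * Num.min 1 (vec z 0 i)).

Definition immigration (R : realType) (d : nat) (p : cbi_params R d)
    (lam : orthant R d) : R :=
  dotp (cbi_beta p) lam
  + \int[cbi_nu p]_(r in @punctured R d) (1 - expR (- dotp lam (vec r))).

(* [l] is the derivative at [t] of the restriction of [f] to R_+; it is the
   right derivative when [t = 0]. *)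
Definition is_derive_Rplus (R : realType) (f : R -> R) (t l : R) : Prop :=
  (f s - f t) / (s - t) @[s --> within [set s : R | 0 <= s] t^'] --> l.

(* Functions of time are total on R; only their values on R_+ are ever
   constrained or used. *)
Definition locally_bounded_Rplus (R : realType) (d : nat)
    (w : R -> orthant R d) : Prop :=
  forall T : R, [bounded enorm (w t) | t in `[0, T]].

Definition cumulant_ode (R : realType) (d : nat) (p : cbi_params R d)
    (lam : orthant R d) (w : R -> orthant R d) : Prop :=
  w 0 = lam /\
  forall (i : 'I_d) (t : R), 0 <= t ->
    is_derive_Rplus (fun s => w s 0 i) t (- branching p i (w t)).

(* The third clause is the C^1 property: by the first, the function in it is
   the derivative of the i-th coordinate of [v ^~ lam]. *)
Definition is_cumulant (R : realType) (d : nat) (p : cbi_params R d)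
    (v : R -> orthant R d -> orthant R d) : Prop :=
  forall lam : orthant R d,
  [/\ cumulant_ode p lam (v ^~ lam),
      locally_bounded_Rplus (v ^~ lam),
      forall i : 'I_d, {within [set t : R | 0 <= t],
        continuous (fun t => - branching p i (v t lam))}
    & forall w : R -> orthant R d,
        cumulant_ode p lam w -> locally_bounded_Rplus w ->
        forall t : R, 0 <= t -> w t = v t lam].

(* Kernels of type [R.-pker _ ~> _] have total mass 1: conservativeness is part
   of the type. *)
Definition transition_semigroup (R : realType) (dE : measure_display)
    (E : measurableType dE) (P : R -> R.-pker E ~> E) : Prop :=
  (forall (x : E) (B : set E), measurable B -> P 0 x B = \d_x B) /\
  (forall (s t : R) (x : E) (B : set E), 0 <= s -> 0 <= t -> measurable B ->
     P (s + t) x B = (\int[P s x]_z P t z B)%E).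

Definition natural_filtration (R : realType) (dO dE : measure_display)
    (Omega : measurableType dO) (E : measurableType dE)
    (X : R -> Omega -> E) (s : R) : set (set Omega) :=
  <<s [set X u @^-1` B | u in [set u | 0 <= u <= s] & B in measurable] >>.

(* [Px x] is the law under which the process starts from [x].  The last clause
   is the Markov property
     Px x (X_{s+t} \in B | F_s) = P_t(X_s, B)   a.s.,
   with the conditional probability given by its defining property. *)
Definition markov_process (R : realType) (dO dE : measure_display)
    (Omega : measurableType dO) (E : measurableType dE)
    (P : R -> R.-pker E ~> E) (Px : E -> probability Omega R)
    (X : R -> {mfun Omega >-> E}) : Prop :=
  forall x : E,
  {ae Px x, forall omega, X 0 omega = x} /\
  (forall (s t : R) (A : set Omega) (B : set E), 0 <= s -> 0 <= t ->
     natural_filtration X s A -> measurable B ->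
     Px x (A `&` X (s + t) @^-1` B) =
       (\int[Px x]_(omega in A) P t (X s omega) B)%E).

Definition cbi_semigroup (R : realType) (d : nat) (p : cbi_params R d)
    (P : R -> R.-pker (orthant R d) ~> (orthant R d)) : Prop :=
  transition_semigroup P /\
  exists2 v : R -> orthant R d -> orthant R d, is_cumulant p v &
    forall (t : R) (x lam : orthant R d), 0 <= t ->
      (\int[P t x]_z (expR (- dotp lam (vec z)))%:E)%E =
      (expR (- dotp x (v t lam)
             - \int[lebesgue_measure]_(s in `[0, t])
                 immigration p (v s lam)))%:E.

Definition cbi_process (R : realType) (d : nat) (p : cbi_params R d)
    (dO : measure_display) (Omega : measurableType dO)
    (Px : orthant R d -> probability Omega R)
    (X : R -> {mfun Omega >-> orthant R d}) : Prop :=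
  admissible p /\
  exists2 P : R -> R.-pker (orthant R d) ~> (orthant R d),
    cbi_semigroup p P & markov_process P Px X.

(* Main.v *)
Require Import Defs.
From HB Require Import structures.
From mathcomp Require Import all_boot all_order all_algebra.
From mathcomp Require Import all_classical all_reals all_analysis.
From mathcomp Require Import measurable_realfun.

Set Implicit Arguments.
Unset Strict Implicit.

Import Order.TTheory GRing.Theory Num.Theory.
Import numFieldNormedType.Exports.
Import HBNNSimple.

Local Open Scope classical_set_scope.
Local Open Scope ring_scope.

(** The formula is obtained by conditioning backwards in time.  Given the past
    up to [t_j], the Laplace transform of [X_{t_{j+1}}] at [y_{j+1}] equals
      exp(- <X_{t_j}, v(t_{j+1} - t_j, y_{j+1})>
          - int_0^{t_{j+1} - t_j} psi(v(u, y_{j+1})) du),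
    so the last observation can be removed at the price of a deterministic
    factor and of adding [v(t_{j+1} - t_j, y_{j+1})] to the Laplace variable at
    time [t_j]; this sum is [y_j] by definition.  After the last removal only
    [X_0] is left, and it is almost surely [x].

    The Markov property is given for events: it concerns [P(A, X_{s+t} in B)] for
    [A] in the natural filtration.  Lemma [markov_integral] extends it from the
    indicator of [B] to nonnegative functions of [X_{s+t}], and lemma
    [integral_sub_sigma_algebra] from the indicator of [A] to nonnegative weights
    depending on the past.  Lemma [cbi_markov_laplace] combines them with the
    Laplace transform of the semigroup into the removal step.  The solution [v]
    of the cumulant equation need not be the one that comes with the semigroup,
    but [cbi_laplace] identifies the two by uniqueness. *)

(** * Integration of nonnegative functions *)

(** Every nonnegative measurable function is a nondecreasing limit of
    nonnegative combinations of indicators, so a property that passes to such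
    combinations and limits need only be checked on indicators.  The two
    extensions of the Markov property, first in the future variable and then in
    the past weight, are both instances of this scheme. *)
Lemma ge0_measurable_ind (dT : measure_display) (T : measurableType dT)
    (R : realType) (Q : (T -> \bar R) -> Prop) :
  (forall A : set T, measurable A -> Q (fun x => (\1_A x)%:E)) ->
  (forall (a : R) (f g : T -> \bar R), 0 <= a ->
     measurable_fun setT f -> measurable_fun setT g ->
     (forall x, 0 <= f x)%E -> (forall x, 0 <= g x)%E ->
     Q f -> Q g -> Q (fun x => a%:E * f x + g x)%E) ->
  (forall f : nat -> T -> \bar R,
     (forall n, measurable_fun setT (f n)) ->
     (forall n x, 0 <= f n x)%E ->
     (forall x, {homo f ^~ x : m n / (m <= n)%N >-> (m <= n)%E}) ->
     (forall n, Q (f n)) -> Q (fun x => limn (f ^~ x))) ->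
  forall f : T -> \bar R,
    measurable_fun setT f -> (forall x, 0 <= f x)%E -> Q f.
Proof.
move=> Q1 QD Qlim f mf f0.
pose f_ := nnsfun_approx measurableT mf.
have -> : f = fun x => limn (fun n => (f_ n x)%:E).
  by apply/funext => x; apply/esym/cvg_lim => //; exact: cvg_nnsfun_approx.
apply: (Qlim (fun n x => (f_ n x)%:E)) => [n|n x|x m n mn|n].
- exact/measurable_EFinP.
- by rewrite lee_fin.
- by rewrite lee_fin; exact/lefP/nd_nnsfun_approx.
(* A simple function is the combination, over the finite list of its values,
   of the indicators of its fibres. *)
have Qsimple (g : {nnsfun T >-> R}) : Q (fun x => (g x)%:E).
  have [s gE] : exists s : seq R, all (>= 0) s /\
      (fun x => (g x)%:E) =
      (fun x => (\sum_(r <- s) r * \1_(g @^-1` [set r]) x)%:E).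
    exists (finmap.enum_fset (fset_set (range g))); split.
      apply/allP => r /=.
      rewrite in_fset_set; last exact: fimfunP.
      by rewrite inE => -[x _ <-].
    apply/funext => x; rewrite {1}fimfunE fsbig_finite//=; exact: fimfunP.
  case: gE => + ->.
  elim: s => [_|r s IH /= /andP[r0 s0]].
    rewrite [X in Q X](_ : _ = fun x => (\1_set0 x)%:E); first exact: Q1.
    by apply/funext => x; rewrite big_nil indic0.
  have ms (r' : R) : measurable (g @^-1` [set r']) by exact: measurable_sfunP.
  rewrite [X in Q X](_ : _ = (fun x => r%:E * (\1_(g @^-1` [set r]) x)%:E +
      (\sum_(i <- s) i * \1_(g @^-1` [set i]) x)%:E)%E); last first.
    by apply/funext => x; rewrite big_cons EFinD EFinM.
  apply: QD => //.
  - exact/measurable_EFinP/measurable_indic.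
  - apply/measurable_EFinP; apply: measurable_sum => i.
    by apply: measurable_funM => //; exact: measurable_indic.
  - move=> x; rewrite lee_fin big_seq; apply: sumr_ge0 => i /(allP s0) i0.
    exact: mulr_ge0.
  - exact: Q1.
  - exact: IH.
exact: Qsimple.
Qed.

(** If [phi] and [psi] have the same integral over each event of a
    sub-sigma-algebra, they have the same conditional expectation, hence remain
    indistinguishable when integrated against any weight [G] that is measurable
    for it.  The functions are real-valued so that multiplication by their
    values commutes with monotone limits. *)
Lemma integral_sub_sigma_algebra (dO : measure_display)
    (Omega : measurableType dO) (R : realType)
    (mu : {measure set Omega -> \bar R}) (S : set (set Omega))
    (phi psi : Omega -> R) (G : g_sigma_algebraType S -> \bar R) :
  <<s S >> `<=` measurable ->
  measurable_fun setT phi -> (forall w, 0 <= phi w) ->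
  measurable_fun setT psi -> (forall w, 0 <= psi w) ->
  (forall A, <<s S >> A ->
     (\int[mu]_(w in A) (phi w)%:E = \int[mu]_(w in A) (psi w)%:E)%E) ->
  measurable_fun setT G -> (forall w, 0 <= G w)%E ->
  (\int[mu]_w (G w * (phi w)%:E) = \int[mu]_w (G w * (psi w)%:E))%E.
Proof.
move=> sS mphi phi0 mpsi psi0 eqA.
have mS (F : g_sigma_algebraType S -> \bar R) : measurable_fun setT F ->
    measurable_fun setT (F : Omega -> \bar R).
  by move=> mF _ B mB; apply: sS; exact: mF.
pose Q (F : g_sigma_algebraType S -> \bar R) :=
  (\int[mu]_w (F w * (phi w)%:E) = \int[mu]_w (F w * (psi w)%:E))%E.
move: G; apply: (@ge0_measurable_ind _ _ _ Q).
- move=> A mA; rewrite /Q.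
  have E (h : Omega -> R) :
      (\int[mu]_w ((\1_A w)%:E * (h w)%:E) = \int[mu]_(w in A) (h w)%:E)%E.
    rewrite [RHS]integral_mkcond epatch_indic.
    by apply: eq_integral => w _ /=; rewrite muleC.
  by rewrite !E; exact: eqA.
- move=> a f g a0 mf mg f0 g0 Qf Qg; rewrite /Q.
  have E (h : Omega -> R) : measurable_fun setT h ->
      (forall w, 0 <= h w) ->
      (\int[mu]_w ((a%:E * f w + g w) * (h w)%:E) =
       a%:E * \int[mu]_w (f w * (h w)%:E) + \int[mu]_w (g w * (h w)%:E))%E.
    move=> /measurable_EFinP mh hR.
    have h0 w : (0 <= (h w)%:E)%E by rewrite lee_fin.
    under eq_integral => w _ do
      rewrite ge0_muleDl ?mule_ge0 ?lee_fin// -muleA.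
    have mfh : measurable_fun setT (fun w : Omega => f w * (h w)%:E)%E.
      by apply: emeasurable_funM => //; exact: mS.
    rewrite ge0_integralD//.
    + by rewrite ge0_integralZl_EFin// => w _; exact: mule_ge0.
    + by move=> w _; rewrite !mule_ge0.
    + exact: measurable_funeM.
    + by move=> w _; exact: mule_ge0.
    + by apply: emeasurable_funM => //; exact: mS.
  by rewrite (E phi)// (E psi mpsi psi0) Qf Qg.
- move=> f mf f0 nd Qf; rewrite /Q.
  have E (h : Omega -> R) : measurable_fun setT h ->
      (forall w, 0 <= h w) ->
      (\int[mu]_w (limn (f ^~ w) * (h w)%:E) =
       limn (fun n => \int[mu]_w (f n w * (h w)%:E)))%E.
    move=> /measurable_EFinP mh hR.
    have h0 w : (0 <= (h w)%:E)%E by rewrite lee_fin.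
    rewrite -monotone_convergence//.
    + apply: eq_integral => w _; rewrite limeMr//.
      exact/ereal_nondecreasing_is_cvgn/nd.
    + by move=> n; apply: emeasurable_funM => //; exact: mS.
    + by move=> n w _; exact: mule_ge0.
    + by move=> w _ m n mn; apply: lee_wpmul2r => //; exact: nd.
  have QfE : (fun n => \int[mu]_w (f n w * (phi w)%:E))%E =
      (fun n => \int[mu]_w (f n w * (psi w)%:E))%E.
    by apply/funext => n; exact: Qf.
  rewrite (E phi mphi phi0) (E psi mpsi psi0).
  exact: (congr1 (fun u : nat -> \bar R => limn u) QfE).
Qed.

Lemma measurable_sum_nat (dT : measure_display) (T : measurableType dT)
    (R : realType) (m n : nat) (h : nat -> T -> R) :
  (forall i, (m <= i < n)%N -> measurable_fun setT (h i)) ->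
  measurable_fun setT (fun x => \sum_(m <= i < n) h i x).
Proof.
move=> mh; under eq_fun do rewrite big_nat_cond big_mkcond.
apply: measurable_sum => i.
case: (boolP ((m <= i < n)%N && true)) => [/andP[mi _]|_]; first exact: mh.
exact: measurable_cst.
Qed.

(** * The Markov property for functions *)

(** The generators of the natural filtration at time [s]: a function is
    measurable for that sigma-algebra exactly when it is measurable on the type
    [g_sigma_algebraType (observed_events X s)]. *)
Definition observed_events (R : realType) (dO dE : measure_display)
    (Omega : measurableType dO) (E : measurableType dE)
    (X : R -> {mfun Omega >-> E}) (s : R) : set (set Omega) :=
  [set X u @^-1` B | u in [set u | 0 <= u <= s] & B in measurable].

Lemma natural_filtration_sub (R : realType) (dO dE : measure_display)
    (Omega : measurableType dO) (E : measurableType dE)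
    (X : R -> {mfun Omega >-> E}) (s : R) :
  natural_filtration X s `<=` measurable.
Proof.
apply: smallest_sub; first exact: sigma_algebra_measurable.
move=> _ [u _ [B mB <-]]; rewrite -[_ @^-1` _]setTI.
exact: measurable_funPT.
Qed.

Lemma natural_filtration_measurable (R : realType) (dO dE : measure_display)
    (Omega : measurableType dO) (E : measurableType dE)
    (X : R -> {mfun Omega >-> E}) (s u : R) :
  0 <= u <= s ->
  measurable_fun setT (X u : g_sigma_algebraType (observed_events X s) -> E).
Proof.
move=> us _ B mB; rewrite setTI.
by apply: sub_sigma_algebra; exists u => //; exists B.
Qed.

(** Both sides are integrals of [f], of the form [\int \int f(z) kappa(w, dz)];
    the Markov property is the case of an indicator [f], and the general one
    follows by linearity and monotone convergence. *)
Lemma markov_integral (dO dE : measure_display) (R : realType)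
    (Omega : measurableType dO) (E : measurableType dE)
    (P : R -> R.-pker E ~> E) (Px : E -> probability Omega R)
    (X : R -> {mfun Omega >-> E}) (x : E) (s t : R) (A : set Omega)
    (f : E -> \bar R) :
  markov_process P Px X -> 0 <= s -> 0 <= t ->
  measurable A -> natural_filtration X s A ->
  measurable_fun setT f -> (forall z, 0 <= f z)%E ->
  (\int[Px x]_(w in A) f (X (s + t)%R w) =
   \int[Px x]_(w in A) \int[P t (X s w)]_z f z)%E.
Proof.
move=> mP s0 t0 mA sA.
have mX u : measurable_fun setT (X u) by exact: measurable_funPT.
have mXA u : measurable_fun A (X u).
  exact: measurable_funTS.
have mint (h : E -> \bar R) : measurable_fun setT h ->
    (forall z, 0 <= h z)%E -> measurable_fun setT (fun w => \int[P t (X s w)]_z h z)%E.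
  move=> mh h0.
  apply: (measurableT_comp (f := fun y => \int[P t y]_z h z)%E) => //.
  by apply: measurable_fun_integral_kernel => // U mU; exact: measurable_kernel.
have mintA (h : E -> \bar R) : measurable_fun setT h ->
    (forall z, 0 <= h z)%E -> measurable_fun A (fun w => \int[P t (X s w)]_z h z)%E.
  by move=> mh h0; apply: measurable_funTS; exact: mint.
have mhA (h : E -> \bar R) u : measurable_fun setT h ->
    measurable_fun A (fun w => h (X u w)).
  by move=> mh; apply: (measurableT_comp mh).
pose Q (h : E -> \bar R) := (\int[Px x]_(w in A) h (X (s + t)%R w) =
   \int[Px x]_(w in A) \int[P t (X s w)]_z h z)%E.
move: f; apply: (@ge0_measurable_ind _ _ _ Q).
- move=> B mB; rewrite /Q.
  under [RHS]eq_integral => w _ do rewrite integral_indic// setIT.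
  rewrite -(mP x).2//.
  have mXB : measurable (X (s + t)%R @^-1` B).
    by rewrite -[_ @^-1` _]setTI; exact: mX.
  by rewrite setIC -integral_indic.
- move=> a f g a0 mf mg f0 g0 Qf Qg; rewrite /Q.
  have af0 z : (0 <= a%:E * f z)%E by rewrite mule_ge0.
  rewrite ge0_integralD; first last.
  + exact: mhA.
  + by [].
  + exact: measurable_funeM (mhA _ _ mf).
  + by [].
  + exact: mA.
  rewrite ge0_integralZl_EFin; first last.
  + exact: a0.
  + exact: mhA.
  + by [].
  + exact: mA.
  under [RHS]eq_integral => w _.
    rewrite ge0_integralD//; last exact: measurable_funeM.
    rewrite ge0_integralZl_EFin//.
    over.
  rewrite ge0_integralD//; last 4 first.
  + by move=> w _; rewrite mule_ge0// integral_ge0.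
  + by apply: measurable_funeM; exact: mintA.
  + by move=> w _; rewrite integral_ge0.
  + exact: mintA.
  rewrite ge0_integralZl_EFin//; last 2 first.
  + by move=> w _; rewrite integral_ge0.
  + exact: mintA.
  by rewrite Qf Qg.
- move=> f mf f0 nd Qf; rewrite /Q.
  rewrite (@monotone_convergence _ _ _ _ _ mA
    (fun n w => f n (X (s + t)%R w)))//; last by move=> n; exact: mhA.
  under [RHS]eq_integral => w _.
    rewrite (@monotone_convergence _ _ _ _ _ measurableT f)//.
    over.
  rewrite monotone_convergence//.
  + by congr (limn _); apply/funext => n; exact: Qf.
  + by move=> n; exact: mintA.
  + by move=> n w _; exact: integral_ge0.
  + move=> w _ m n mn; apply: ge0_le_integral => // z _; exact: nd.
Qed.

(** * Laplace transforms on the orthant *)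

Lemma dotpC (R : realType) (d : nat) (a b : 'rV[R]_d) : dotp a b = dotp b a.
Proof. by apply: eq_bigr => i _; rewrite mulrC. Qed.

Lemma dotpDl (R : realType) (d : nat) (a b c : 'rV[R]_d) :
  dotp (a + b) c = dotp a c + dotp b c.
Proof.
by rewrite /dotp -big_split; apply: eq_bigr => i _; rewrite mxE mulrDl.
Qed.

Lemma measurable_dotp (R : realType) (d : nat) (a : 'rV[R]_d) :
  measurable_fun setT (fun z : orthant R d => dotp a (vec z)).
Proof.
rewrite /dotp; apply: measurable_sum => i; apply: measurable_funM => //.
have cz : continuous (fun z : orthant R d => vec z 0 i).
  move=> z; apply: (@continuous_comp _ _ _ (fun z : orthant R d => vec z)
    (fun M : 'rV[R]_d => M 0 i)).
    exact: initial_continuous.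
  exact: coord_continuous.
apply: (measurability _ (RGenOpens.measurableE R)) => _ [_ [a' [b' ->] <-]].
apply: sub_sigma_algebra; rewrite setTI.
by move/continuousP: cz; apply; exact: interval_open.
Qed.

Lemma measurable_expR_dotp (R : realType) (d : nat) (a : 'rV[R]_d) :
  measurable_fun setT (fun z : orthant R d => expR (- dotp a (vec z))).
Proof.
apply: measurableT_comp => //; apply: measurableT_comp => //.
exact: measurable_dotp.
Qed.

(** * Laplace transforms of CBI processes *)

(** The semigroup comes with its own solution of the cumulant equation; by
    uniqueness of the locally bounded solution it agrees with [v] at all
    nonnegative times. *)
Lemma cbi_laplace (R : realType) (d : nat) (p : cbi_params R d)
    (P : R -> R.-pker (orthant R d) ~> (orthant R d))
    (v : R -> orthant R d -> orthant R d) (t : R) (x lam : orthant R d) :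
  cbi_semigroup p P -> is_cumulant p v -> 0 <= t ->
  (\int[P t x]_z (expR (- dotp lam (vec z)))%:E)%E =
  (expR (- dotp x (v t lam)
         - \int[lebesgue_measure]_(s in `[0, t]) immigration p (v s lam)))%:E.
Proof.
move=> [_ [v' hv' hP]] hv t0; rewrite (hP t x lam t0).
have [_ _ _ v_uniq] := hv lam.
have [ode' bd' _ _] := hv' lam.
have v'E (u : R) : 0 <= u -> v' u lam = v u lam.
  by apply: (v_uniq (v' ^~ lam)).
have psiE : \int[lebesgue_measure]_(s in `[0, t]) immigration p (v' s lam) =
    \int[lebesgue_measure]_(s in `[0, t]) immigration p (v s lam).
  apply: eq_Rintegral => u; rewrite inE /= in_itv /= => /andP[u0 _].
  by rewrite (v'E u u0).
rewrite (v'E t t0).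
exact: (congr1 (fun r => (expR (- dotp x (v t lam) - r))%:E) psiE).
Qed.

(** Conditionally on the past up to time [s], the Laplace transform of
    [X (s + t)] at [lam] is the exponential of an affine function of [X s]: its
    slope is [- v t lam], and its constant term is deterministic and leaves the
    integral.  Thus a further observation at time [s + t] trades for a shift of
    the Laplace variable at time [s]. *)
Lemma cbi_markov_laplace (R : realType) (d : nat) (p : cbi_params R d)
    (dO : measure_display) (Omega : measurableType dO)
    (Px : orthant R d -> probability Omega R)
    (X : R -> {mfun Omega >-> orthant R d})
    (v : R -> orthant R d -> orthant R d)
    (x lam : orthant R d) (s t : R)
    (G : g_sigma_algebraType (observed_events X s) -> \bar R) :
  cbi_process p Px X -> is_cumulant p v -> 0 <= s -> 0 <= t ->
  measurable_fun setT G -> (forall w, 0 <= G w)%E ->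
  (\int[Px x]_w (G w * (expR (- dotp lam (vec (X (s + t)%R w))))%:E) =
   (expR (- \int[lebesgue_measure]_(u in `[0, t]) immigration p (v u lam)))%:E *
   \int[Px x]_w (G w * (expR (- dotp (v t lam) (vec (X s w))))%:E))%E.
Proof.
move=> [_ [P hP hX]] hv s0 t0 mG G0.
have mX u : measurable_fun setT (X u) by exact: measurable_funPT.
pose c :=
  expR (- \int[lebesgue_measure]_(u in `[0, t]) immigration p (v u lam)).
have me (l : orthant R d) u :
    measurable_fun setT (fun w => expR (- dotp l (vec (X u w)))).
  by apply: (measurableT_comp (measurable_expR_dotp (vec l))).

have mGO : measurable_fun setT (G : Omega -> \bar R).
  move=> _ B mB; apply: (@natural_filtration_sub _ _ _ _ _ X s).
  exact: mG.
rewrite (@integral_sub_sigma_algebra _ _ _ _ _ _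
  (fun w => c * expR (- dotp (v t lam) (vec (X s w)))) G)//.
- under eq_integral => w _ do rewrite EFinM muleCA.
  rewrite ge0_integralZl_EFin//.
  + by move=> w _; rewrite mule_ge0 ?lee_fin ?expR_ge0.
  + by apply: emeasurable_funM => //; exact/measurable_EFinP/me.
  + exact: expR_ge0.
- exact: natural_filtration_sub.
- by apply: measurable_funM.
- by move=> w; rewrite mulr_ge0 ?expR_ge0.
- move=> A sA.
  rewrite (@markov_integral _ _ _ _ _ P Px X x s t A
    (fun z => (expR (- dotp lam (vec z)))%:E))//.
  + apply: eq_integral => w _; rewrite (cbi_laplace _ _ hP hv t0).
    by rewrite expRD mulrC dotpC.
  + exact: (@natural_filtration_sub _ _ _ _ _ X s A sA).
  + by apply/measurable_EFinP; exact: (measurable_expR_dotp (vec lam)).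
Qed.

Unset Implicit Arguments.
Set Strict Implicit.

Theorem propositionA1 (R : realType) (d : nat) (p : cbi_params R d)
  (dO : measure_display) (Omega : measurableType dO)
  (Px : orthant R d -> probability Omega R)
  (X : R -> {mfun Omega >-> orthant R d})
  (v : R -> orthant R d -> orthant R d)
  (x : orthant R d) (k : nat) (t : nat -> R) (lam y : nat -> orthant R d)
  (hX : cbi_process p Px X)
  (hnu : (\int[cbi_nu p]_(r in @punctured R d)
            (enorm (vec r) * \1_[set r' : orthant R d | (1 <= enorm r')%R] r)%:E
          < +oo)%E)
  (hv : is_cumulant p v)
  (hk : (1 <= k)%N)
  (ht0 : t 0%N = 0)
  (ht : forall i, (i < k)%N -> t i <= t i.+1)
  (hyk : y k = lam k)
  (hy : forall i, (1 <= i < k)%N ->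
     vec (y i) = vec (lam i) + vec (v (t i.+1 - t i) (y i.+1))) :
  ('E_(Px x)[fun omega =>
      expR (- \sum_(1 <= i < k.+1) dotp (lam i) (vec (X (t i) omega)))])%E =
  (expR (- dotp x (v (t 1%N) (y 1%N))
         - \sum_(1 <= i < k.+1)
             \int[lebesgue_measure]_(u in `[0, t i - t i.-1])
               immigration p (v u (y i))))%:E.
Proof.
have t_mono i j : (i <= j <= k)%N -> t i <= t j.
  elim: j => [|j IH]; first by rewrite leqn0 => /andP[/eqP->].
  rewrite leq_eqVlt ltnS => /andP[/orP[/eqP->//|ij] jk].
  by rewrite (le_trans (IH _)) ?ht// ij ltnW.
have t_ge0 j : (j <= k)%N -> 0 <= t j by rewrite -ht0 => jk; exact: t_mono.
(* [past j] is the weight carried by the observations before the j-th one. *)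
pose past j w := expR (- \sum_(1 <= i < j) dotp (lam i) (vec (X (t i) w))).
pose psi j := \int[lebesgue_measure]_(u in `[0, t j - t j.-1])
  immigration p (v u (y j)).
have mpast j : (j < k)%N ->
    measurable_fun setT
      (fun w : g_sigma_algebraType (observed_events X (t j)) =>
      (past j.+1 w)%:E).
  move=> jk; apply/measurable_EFinP.
  apply: (measurableT_comp (f := @expR R)) => //.
  apply: measurable_funN.
  apply: measurable_sum_nat => i /andP[i1 ij].
  apply: (measurableT_comp (measurable_dotp _)).
  apply: natural_filtration_measurable.
  have ij' : (i <= j <= k)%N by rewrite -ltnS ij ltnW.
  by rewrite t_ge0 ?t_mono//; case/andP: ij'; exact: leq_trans.
have step j : (j < k)%N ->
    (\int[Px x]_w
       (past j.+1 w * expR (- dotp (y j.+1) (vec (X (t j.+1) w))))%:E =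
     (expR (- psi j.+1))%:E * \int[Px x]_w
       (past j.+1 w *
        expR (- dotp (v (t j.+1 - t j) (y j.+1)) (vec (X (t j) w))))%:E)%E.
  move=> jk.
  have := @cbi_markov_laplace _ _ _ _ _ _ _ v x (y j.+1) (t j) (t j.+1 - t j)
    _ hX hv (t_ge0 j (ltnW jk)) _ (mpast j jk) _.
  rewrite subrKC; apply; first by rewrite subr_ge0 ht.
  by move=> w; rewrite lee_fin expR_ge0.
(* The identity for the first j + 1 observations, the last of which is taken at
   the accumulated variable [y j.+1] instead of [lam j.+1]. *)
have main j : (j < k)%N ->
    (\int[Px x]_w
       (past j.+1 w * expR (- dotp (y j.+1) (vec (X (t j.+1) w))))%:E =
     (expR (- dotp x (v (t 1%N) (y 1%N)) - \sum_(1 <= i < j.+2) psi i))%:E)%E.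
  elim: j => [|j IH] jk; rewrite step//.
    rewrite big_nat1 expRD EFinM [RHS]muleC; congr (_ * _)%E.
    (* At t_0 = 0 the past weight is trivial, and X_0 = x almost surely. *)
    have [_ [P _ /(_ x)[X0 _]]] := hX.
    rewrite ht0 subr0.
    rewrite (@ae_eq_integral _ _ _ _ _
      (fun=> (expR (- dotp x (v (t 1%N) (y 1%N))))%:E))//.
    + by rewrite integral_cst// [X in (_ * X)%E](probability_setT (Px x)) mule1.
    + apply/measurable_EFinP; apply: measurable_funM.
        rewrite /past; under eq_fun do rewrite big_nil. exact: measurable_cst.
      by apply: (measurableT_comp (measurable_expR_dotp _)).
    + apply: filterS X0 => w X0w _.
      by rewrite /past big_nil oppr0 expR0 mul1r X0w dotpC.
  rewrite big_nat_recr//= opprD addrA expRD EFinM -IH 1?ltnW// muleC.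
  apply: (congr1 (fun r => r * _)%E); apply: eq_integral => w _; congr EFin.
  (* The observation at [lam j.+1] and the term brought back from time
     [t j.+2] merge into one observation at [y j.+1]. *)
  rewrite /past big_nat_recr//= opprD expRD -mulrA -expRD -opprD hy ?ltnS//.
  by rewrite dotpDl.
rewrite unlock.
case: k hk hyk hy main {ht t_mono t_ge0 mpast step} => // k _ hyk _ main.
apply: etrans (main k (ltnSn k)); apply: eq_integral => w _; congr EFin.
by rewrite big_nat_recr//= opprD expRD hyk.
Qed.
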